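(* Let $G$ be a convex bipartite graph with maximum degree $\Delta\ge 1$. Then $\chi(G^2)\le 2\Delta$. Moreover, there exist convex bipartite graphs $G$ with $\chi(G^2)=2\Delta$, where $\Delta$ is the maximum degree of $G$.
   Context: All graphs are finite, undirected and simple. $\chi$ denotes the chromatic number. The square $G^2$ of a graph $G$ has the same vertex set as $G$, and two distinct vertices are adjacent in $G^2$ iff their distance in $G$ is at most two. A bipartite graph $G=(A,B,E)$ is convex bipartite if the vertices of $B$ have a linear ordering such that for each $a\in A$ the neighbours of $a$ in $G$ appear consecutively in the ordering. *)

(* Defs.v *)
From mathcomp Require Import all_boot.

Set Implicit Arguments.
Unset Strict Implicit.
Unset Printing Implicit Defensive.

Record sgraph := SGraph {
  vertex :> finType;
  adj : rel vertex;
  adj_sym : symmetric adj;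
  adj_irr : irreflexive adj }.

Definition max_degree (G : sgraph) : nat :=
  \max_(x : G) #|[set y | adj x y]|.

Section Distance.
Variable G : sgraph.

Definition walk (k : nat) (x y : G) : bool :=
  [exists p : k.-tuple G, path (@adj G) x p && (last x p == y)].

(* Relational, so that vertices in different components are at no distance. *)
Definition is_dist (x y : G) (d : nat) : bool :=
  walk d x y && [forall i : 'I_d, ~~ walk i x y].

Definition square_adj : rel G :=
  fun x y => (x != y) && [exists d : 'I_3, is_dist x y d].

Lemma walk_sym k : symmetric (walk k).
Proof.
suff H x y : walk k x y -> walk k y x by move=> x y; apply/idP/idP; apply: H.
case/existsP => p /andP [px /eqP lp].
have sz : size (rev (belast x p)) == k by rewrite size_rev size_belast size_tuple.
apply/existsP; exists (Tuple sz) => /=; rewrite -lp rev_path.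
rewrite (eq_path (e' := @adj G)) ?px /=; last by move=> u v; rewrite adj_sym.
by case: (tval p) => //= z q; rewrite rev_cons last_rcons.
Qed.

Lemma square_adj_sym : symmetric square_adj.
Proof.
move=> x y; rewrite /square_adj eq_sym; congr andb.
apply: eq_existsb => d; rewrite /is_dist walk_sym; congr andb.
by apply: eq_forallb => i; rewrite walk_sym.
Qed.

Lemma square_adj_irr : irreflexive square_adj.
Proof. by move=> x; rewrite /square_adj eqxx. Qed.

Definition square : sgraph := SGraph square_adj_sym square_adj_irr.

End Distance.

Definition colorable (G : sgraph) (k : nat) : bool :=
  [exists c : {ffun G -> 'I_k},
     [forall x : G, forall y : G, adj x y ==> (c x != c y)]].

Lemma colorable_ex (G : sgraph) : exists k, colorable G k.
Proof.
exists #|G|; apply/existsP; exists [ffun x => enum_rank x].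
apply/forallP => x; apply/forallP => y; apply/implyP => xy.
rewrite !ffunE (inj_eq enum_rank_inj).
by apply: contraTneq xy => ->; rewrite adj_irr.
Qed.

Definition chromatic (G : sgraph) : nat := ex_minn (colorable_ex G).

Definition bipartition (G : sgraph) (A B : {set G}) : Prop :=
  [/\ A :|: B = setT, [disjoint A & B] &
      forall x y : G, adj x y ->
        (x \in A) && (y \in B) || (x \in B) && (y \in A)].

(* A linear ordering of B is a duplicate-free enumeration s of B; the
   neighbours of a, listed in that order, must form a contiguous block of s. *)
Definition convex_ordering (G : sgraph) (A B : {set G}) (s : seq G) : Prop :=
  [/\ uniq s, s =i B & forall a, a \in A -> infix [seq b <- s | adj a b] s].

Definition convex_bipartite (G : sgraph) : Prop :=
  exists A B : {set G},
    bipartition A B /\ exists s : seq G, convex_ordering A B s.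

(* Main.v *)
Require Import Defs.
From mathcomp Require Import all_boot.
From mathcomp Require Import zify.

Set Implicit Arguments.
Unset Strict Implicit.
Unset Printing Implicit Defensive.

(** The two sides receive disjoint palettes of Delta colours.  Two vertices of
    B with a common neighbour lie in a block of at most Delta consecutive
    positions, so position modulo Delta colours B.  The neighbourhoods of the
    vertices of A are intervals of positions; those meeting the interval of a
    and starting no later than it all contain its left end, so there are at
    most Delta of them including a, and colouring by left end is greedy.
    Equality holds for a single edge. *)

(** Vertices are coloured by increasing [r]: the induction sets aside a vertex [x] of maximal rank
    in [S], so the degree hypothesis counts all its neighbours in [S] and some colour stays free for
    it. Ties in rank count at both ends, so their order is irrelevant. *)
Lemma greedy_coloring (T : finType) (e : rel T) (r : T -> nat) (k : nat) :
  symmetric e ->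
  (forall x, #|[set y | e x y && (r y <= r x)]| < k) ->
  exists c : T -> nat,
    (forall x, c x < k) /\ (forall x y, x != y -> e x y -> c x != c y).
Proof.
move=> e_sym deg_lt.
suff col (S : {set T}) : exists c : T -> nat,
    (forall x, c x < k) /\
    {in S &, forall x y, x != y -> e x y -> c x != c y}.
  have [c [c_lt c_ok]] := col setT.
  by exists c; split=> // x y; apply: c_ok; rewrite inE.
have [n] := ubnP #|S|; elim: n S => // n IHn S.
have [-> _ | [x0 x0S] S_lt] := set_0Vmem S.
  exists (fun=> 0); split=> [x|x y]; last by rewrite inE.
  exact: leq_ltn_trans (deg_lt x).
have [x xS x_max] : exists2 x, x \in S & {in S, forall y, r y <= r x}.
  by case: (arg_maxnP r x0S) => x xS x_max; exists x.
have [|c [c_lt c_ok]] := IHn (S :\ x).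
  by move: S_lt; rewrite (cardsD1 x S) xS.
(* [N] may reach outside [S], where the values of [c] are arbitrary; this only enlarges [used],
   which still has fewer than [k] colours. *)
pose N := [set y | e x y && (r y <= r x)].
pose used := [set i : 'I_k | [exists y in N, c y == i]].
have [i i_free] : exists i : 'I_k, i \notin used.
  have used_sub : used \subset [set Ordinal (c_lt y) | y in N].
    apply/subsetP => i; rewrite inE => /existsP[y /andP[yN /eqP cy]].
    by apply/imsetP; exists y => //; apply: val_inj.
  apply/existsP; rewrite -negb_forall; apply/negP => /forallP used_all.
  have := leq_trans (subset_leq_card used_sub) (leq_imset_card _ _).
  have -> : used = setT by apply/setP => i; rewrite [RHS]inE used_all.
  by rewrite cardsT card_ord leqNgt deg_lt.
have i_ok y : y \in S -> e x y -> c y != i.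
  move=> yS exy; apply: contra i_free => cy; rewrite inE.
  by apply/existsP; exists y; rewrite inE exy cy /= andbT; apply: x_max.
exists (fun y => if y == x then val i else c y); split.
  by move=> y; case: ifP; rewrite ?c_lt ?ltn_ord.
move=> y z yS zS neq_yz eyz.
have [eq_yx|neq_yx] := eqVneq y x; have [eq_zx|neq_zx] := eqVneq z x.
- by rewrite eq_yx eq_zx eqxx in neq_yz.
- by rewrite eq_sym i_ok -?eq_yx.
- by rewrite i_ok -?eq_zx 1?e_sym.
- by apply: c_ok => //; rewrite !inE ?neq_yx ?neq_zx.
Qed.

(** Write [s = s1 ++ filter p s ++ s3]. Entries are distinct, so the entries satisfying [p] are
    exactly those of the middle block, which starts at position [size s1]. *)
Lemma infix_filter_interval (T : eqType) (p : pred T) (s : seq T) :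
  uniq s -> infix (filter p s) s ->
  exists m, {in s, forall x, p x = (m <= index x s < m + count p s)}.
Proof.
move=> s_uniq /infixP[s1 [s3 s_eq]]; exists (size s1) => x xs.
have -> : p x = (x \in filter p s) by rewrite mem_filter xs andbT.
move: s_uniq xs; rewrite -size_filter.
move: (filter p s) s_eq => f ->.
rewrite catA cat_uniq cat_uniq => /and3P[/and3P[_ dis1 _] _ _].
rewrite !mem_cat !index_cat mem_cat size_cat.
have [xs1 _ | xs1] := boolP (x \in s1).
  rewrite leqNgt index_mem xs1 /=; apply/negbTE; apply: contra dis1 => xf.
  by apply/hasP; exists x.
have [xf _ | xf /= _] := boolP (x \in f).
  by rewrite leq_addr ltn_add2l index_mem.
by rewrite [(_ < _)]ltnNge leq_addr andbF.
Qed.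

Lemma square_adj_path (G : sgraph) (x y : G) :
  square_adj x y ->
  x != y /\ (adj x y \/ exists2 z, adj x z & adj z y).
Proof.
case/andP=> neq_xy /existsP[d /andP[/existsP[p /andP[xp /eqP yE]] _]].
split=> //; have := ltn_ord d; rewrite -[nat_of_ord d](size_tuple p).
case: (tval p) xp yE => [_ /= eq_xy|z [|y' [|//]]] /=.
- by rewrite eq_xy eqxx in neq_xy.
- by rewrite andbT => xz <-; left.
- by rewrite andbT => /andP[xz zy] <-; right; exists z.
Qed.

Lemma leq_degree (G : sgraph) (x : G) :
  #|[set y | adj x y]| <= max_degree G.
Proof. exact: leq_bigmax. Qed.

Lemma colorableP (G : sgraph) (k : nat) :
  reflect (exists c : G -> nat,
             (forall x, c x < k) /\ (forall x y, adj x y -> c x != c y))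
          (colorable G k).
Proof.
apply: (iffP existsP) => [[c /forallP c_ok]|[c [c_lt c_ok]]].
  exists (fun x => val (c x)); split=> [x|x y xy]; first exact: ltn_ord.
  by have /forallP/(_ y)/implyP/(_ xy) := c_ok x.
exists [ffun x => Ordinal (c_lt x)].
apply/forallP => x; apply/forallP => y; apply/implyP => xy.
by rewrite !ffunE -val_eqE /= c_ok.
Qed.

Lemma chromatic_leq (G : sgraph) (k : nat) : colorable G k -> chromatic G <= k.
Proof. by rewrite /chromatic; case: ex_minnP => m _; apply. Qed.

Lemma chromatic_colorable (G : sgraph) : colorable G (chromatic G).
Proof. by rewrite /chromatic; case: ex_minnP. Qed.

Section ConvexBipartite.
Variables (G : sgraph) (A B : {set G}) (s : seq G).
Hypotheses (AB_bip : bipartition A B) (s_conv : convex_ordering A B s).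
Local Notation D := (max_degree G).

Lemma bipartition_notin (x : G) : (x \notin A) = (x \in B).
Proof.
case: AB_bip => AB_T AB_dis _; have := in_setT x; rewrite -AB_T inE.
by have [xA _|//] := boolP (x \in A); rewrite (disjointFr AB_dis xA).
Qed.

(** As a Boolean equation this both carries sides across an edge and, with [bipartition_notin],
    excludes edges inside a side. *)
Lemma bipartition_adj (x y : G) : adj x y -> (x \in A) = (y \in B).
Proof.
case: AB_bip => _ _ /[apply]; rewrite -!bipartition_notin.
by case: (x \in A); case: (y \in A).
Qed.

(** The length [n] counts the entries of the duplicate-free [s] adjacent to [a], hence is at most
    the degree of [a]. *)
Lemma convex_interval (a : G) : a \in A ->
  exists m n, n <= D /\ {in B, forall b, adj a b = (m <= index b s < m + n)}.
Proof.
case: s_conv => s_uniq sB s_infix aA.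
have [m m_int] := infix_filter_interval s_uniq (s_infix a aA).
exists m, (count (adj a) s); split; last by move=> b bB; rewrite m_int ?sB.
apply: leq_trans (leq_degree a); rewrite -size_filter.
rewrite -(card_uniqP (filter_uniq (adj a) s_uniq)).
by apply/subset_leq_card/subsetP => b; rewrite mem_filter inE => /andP[].
Qed.

Lemma convex_coloring_right (b b' a : G) :
  b \in B -> b' \in B -> b != b' -> adj a b -> adj a b' ->
  index b s %% D != index b' s %% D.
Proof.
move=> bB b'B neq_bb' ab ab'; have aA : a \in A by rewrite (bipartition_adj ab).
have [m [n [nD int]]] := convex_interval aA.
move: ab ab'; rewrite !int // => b_int b'_int.
have neq_i : index b s != index b' s.
  apply: contraNneq neq_bb' => eq_i; case: s_conv => _ sB _.
  by rewrite -[b](nth_index b (s := s)) ?sB // eq_i nth_index ?sB.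
wlog lt_i : b b' {bB b'B neq_bb'} b_int b'_int neq_i / index b s < index b' s.
  move=> W; case: (ltngtP (index b s) (index b' s)) => [| |/eqP].
  - exact: W.
  - by rewrite eq_sym; apply: W; rewrite // eq_sym.
  - by rewrite (negbTE neq_i).
(* Both positions lie in a window of length [n <= D], so their difference is positive and below [D],
   hence not divisible by [D]. *)
rewrite eq_sym eqn_mod_dvd ?(ltnW lt_i) // gtnNdvd //; lia.
Qed.

Lemma convex_coloring_left : 0 < D ->
  exists c : G -> nat, (forall x, c x < D) /\
    forall a a' b, a \in A -> a' \in A -> a != a' -> adj a b -> adj a' b ->
      c a != c a'.
Proof.
move=> D_gt0.
pose e x y := [&& x \in A, y \in A, x != y & [exists b, adj x b && adj y b]].
(* The left end of the interval of [x]. The default [size s] occurs only when [x] has no neighbour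
   in [s], and such an [x] is in no [e]-conflict. *)
pose r x := find (adj x) s.
have [||c [c_lt c_ok]] := @greedy_coloring G e r D.
- move=> x y; rewrite /e andbCA eq_sym; do 3!congr andb.
  by apply: eq_existsb => b; rewrite andbC.
(* Without conflicts of rank at most [r x], the bound is just [0 < D]; otherwise a conflict supplies
   a neighbour of [x], so its left end [l] exists. *)
- move=> x; have [->|[y0]] := set_0Vmem [set y | e x y && (r y <= r x)].
    by rewrite cards0.
  rewrite inE => /andP[/and4P[xA _ _ /existsP[b0 /andP[xb0 _]]] _].
  case: s_conv => s_uniq sB _.
  have in_s y b : y \in A -> adj y b -> b \in s.
    by move=> yA yb; rewrite sB -(bipartition_adj yb).
  have has_x : has (adj x) s by apply/hasP; exists b0; rewrite ?(in_s x).
  pose l := nth x s (r x).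
  have xl : adj x l := nth_find x has_x.
  have lB : l \in B by rewrite -(bipartition_adj xl).
  have l_idx : index l s = r x by rewrite index_uniq // -has_find.
  (* The inclusion in the neighbourhood of [l] is proper: [x] is adjacent to [l] but not in
     [e]-conflict with itself. This makes the bound strict. *)
  apply: leq_trans (leq_degree l); apply: proper_card; apply/properP; split.
    apply/subsetP => y; rewrite !inE => /andP[/and4P[_ yA _]].
    case/existsP=> b /andP[xb yb] r_le.
    have has_y : has (adj y) s by apply/hasP; exists b; rewrite ?(in_s x).
    pose l' := nth y s (r y).
    have yl' : adj y l' := nth_find y has_y.
    have l'_idx : index l' s = r y by rewrite index_uniq // -has_find.
    have l'B : l' \in B by rewrite -(bipartition_adj yl').
    have bB : b \in B by rewrite -(bipartition_adj xb).
    have r_b : r x <= index b s.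
      rewrite leqNgt; apply/negP => /(before_find x).
      by rewrite nth_index ?(in_s x) // xb.
    (* The position of [l] lies between [r y] and the position of [b], both in the interval of [y];
       hence [y] is adjacent to [l]. *)
    have [m [n [_ int]]] := convex_interval yA.
    rewrite adj_sym; move: yl' yb; rewrite !int // l'_idx l_idx; lia.
  by exists x; rewrite inE ?(adj_sym l) // /e eqxx !andbF.
exists c; split=> // a a' b aA a'A neq_aa' ab a'b; apply: c_ok => //.
by rewrite /e aA a'A neq_aa'; apply/existsP; exists b; rewrite ab.
Qed.

Lemma convex_square_colorable : 0 < D -> colorable (square G) (2 * D).
Proof.
move=> D_gt0; have [c [c_lt c_ok]] := convex_coloring_left D_gt0.
pose c' x := if x \in A then c x else D + index x s %% D.
have mod_lt x : index x s %% D < D by rewrite ltn_mod.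
apply/colorableP; exists c'; split=> [x|x y].
  by rewrite /c'; have := c_lt x; have := mod_lt x; case: ifP => _; lia.
case/square_adj_path=> neq_xy xy; rewrite /c'.
(* On opposite sides the colours come from the ranges below [D] and from [D] on. On the same side
   [x] and [y] cannot be adjacent, so they share a neighbour [z]. *)
have [xA|xA] := boolP (x \in A); have [yA|yA] := boolP (y \in A).
- case: xy => [/bipartition_adj|[z xz zy]].
    by rewrite -bipartition_notin xA yA.
  by apply: (c_ok _ _ z); rewrite // adj_sym.
- by have := c_lt x; lia.
- by have := c_lt y; lia.
rewrite eqn_add2l; case: xy => [/bipartition_adj|[z xz zy]].
  by rewrite -bipartition_notin (negbTE xA) yA.
by apply: (convex_coloring_right (a := z)); rewrite -?bipartition_notin // adj_sym.
Qed.

End ConvexBipartite.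

Lemma neq_bool_sym : symmetric (fun x y : bool => x != y).
Proof. by move=> x y; rewrite eq_sym. Qed.

Lemma neq_bool_irr : irreflexive (fun x y : bool => x != y).
Proof. by move=> x; rewrite eqxx. Qed.

Definition single_edge : sgraph := SGraph neq_bool_sym neq_bool_irr.

Lemma single_edge_convex : convex_bipartite single_edge.
Proof.
exists [set true], [set false]; split.
  split; first by apply/setP => -[]; rewrite !inE.
    by rewrite disjoints1 inE.
  by move=> [] []; rewrite !inE.
exists [:: false]; split=> // [b|a]; rewrite !inE //.
by move/eqP=> ->.
Qed.

Lemma max_degree_single_edge : max_degree single_edge = 1.
Proof.
rewrite /max_degree (eq_bigr (fun=> 1)); last first.
  move=> x _; rewrite -(cards1 (~~ x)); apply: eq_card => y.
  by rewrite !inE; case: x y => [] [].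
by rewrite big_const card_bool.
Qed.

Lemma chromatic_gt1 (G : sgraph) (x y : G) : adj x y -> 1 < chromatic G.
Proof.
move=> xy; have /colorableP[c [c_lt c_ok]] := chromatic_colorable G.
by have := c_ok x y xy; have := c_lt x; have := c_lt y; lia.
Qed.

Lemma adj_square (G : sgraph) (x y : G) : adj x y -> square_adj x y.
Proof.
move=> xy; have neq_xy : x != y by apply: contraTneq xy => ->; rewrite adj_irr.
(* The distance is exactly 1, since a walk of length 0 would force [x = y]. *)
rewrite /square_adj neq_xy; apply/existsP; exists (inord 1).
rewrite /is_dist inordK //; apply/andP; split.
  by apply/existsP; exists [tuple y]; rewrite /= xy eqxx.
apply/forallP => -[[|//] ?]; apply/existsP => -[p].
by rewrite tuple0 /= (negbTE neq_xy).
Qed.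

Theorem theorem4 :
  (forall G : sgraph,
     convex_bipartite G -> 1 <= max_degree G ->
     chromatic (square G) <= 2 * max_degree G) /\
  (exists G : sgraph,
     [/\ convex_bipartite G, 1 <= max_degree G &
         chromatic (square G) = 2 * max_degree G]).
Proof.
have upper (G : sgraph) : convex_bipartite G -> 1 <= max_degree G ->
    chromatic (square G) <= 2 * max_degree G.
  move=> [A [B [bip [s conv]]]] D_gt0; apply: chromatic_leq.
  exact: convex_square_colorable bip conv D_gt0.
split=> //; exists single_edge; have K2 := single_edge_convex.
split; rewrite ?max_degree_single_edge //.
have := upper _ K2; rewrite max_degree_single_edge => /(_ isT) chi_le2.
(* Here [2 * 1] colours are needed because the edge survives in the square. *)
apply/eqP; rewrite eqn_leq chi_le2 /=.
by apply: (@chromatic_gt1 (square single_edge) true false); apply: adj_square.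
Qed.
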